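(* Let $(M,g,J)$ be an almost Hermitian manifold, let $(N,h,J^N)$ be a $(1,2)$-symplectic almost Hermitian manifold, and let $\phi:M\to N$ be a holomorphic map. Then $\phi$ is harmonic if and only if $d\phi(J\delta J)=0$.
   Context: An almost Hermitian manifold $(M^m,g,J)$ is a Riemannian manifold $(M,g)$ of real dimension $2m$ with an almost complex structure $J:TM\to TM$, $J^2=-I$, which is isometric on each tangent space (not assumed integrable). $\nabla$ denotes the Levi-Civita connection. The divergence of $J$ is the vector field $\delta J=\sum_{k=1}^m\{(\nabla_{e_k}J)(e_k)+(\nabla_{Je_k}J)(Je_k)\}$, where $\{e_1,\dots,e_m,Je_1,\dots,Je_m\}$ is any local orthonormal frame. $(N,h,J^N)$ is $(1,2)$-symplectic (quasi-Kähler) if $(\nabla^N_XJ^N)Y+(\nabla^N_{J^NX}J^N)J^NY=0$ for all vector fields $X,Y$ on $N$. A smooth map $\phi:M\to N$ between almost Hermitian manifolds is holomorphic if $d\phi\circ J=J^N\circ d\phi$. The tension field of $\phi$ is the trace of its second fundamental form, $\tau(\phi)=\sum_j\{\nabla^{\phi^{-1}TN}_{e_j}d\phi(e_j)-d\phi(\nabla_{e_j}e_j)\}$ over a local orthonormal frame $\{e_j\}$ of $TM$, with $\nabla^{\phi^{-1}TN}$ the pull-back of the Levi-Civita connection $\nabla^N$ of $N$; $\phi$ is harmonic if $\tau(\phi)=0$. *)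

(* Defs.v *)
From HB Require Import structures.
From mathcomp Require Import all_boot all_order all_algebra.
From mathcomp Require Import all_classical all_reals all_analysis.

Set Implicit Arguments.
Unset Strict Implicit.
Unset Printing Implicit Defensive.

Import Order.TTheory GRing.Theory Num.Theory.
Import numFieldNormedType.Exports.

Local Open Scope classical_set_scope.
Local Open Scope ring_scope.

Fixpoint Ck_on (R : realType) (V W : normedModType R) (k : nat) (U : set V)
    (f : V -> W) : Prop :=
  match k with
  | 0 => forall x, U x -> {for x, continuous f}
  | k'.+1 => (forall x, U x -> differentiable f x) /\
             (forall v : V, Ck_on k' U (fun x => 'D_v f x))
  end.

Definition smooth_on (R : realType) (V W : normedModType R) (U : set V)
  (f : V -> W) : Prop := forall k, Ck_on k U f.

(* An atlas generating the smooth structure is indexed by the points of the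
   manifold, [chart p] being defined around p: from any atlas one obtains such
   a family by choosing a chart around each point. *)
Record manifold (R : realType) (n : nat) := Manifold {
  mf_carrier :> topologicalType;
  mf_hausdorff : hausdorff_space mf_carrier;
  mf_second_countable : @second_countable mf_carrier;
  chart_dom : mf_carrier -> set mf_carrier;
  chart : mf_carrier -> mf_carrier -> 'rV[R]_n;
  chart_inv : mf_carrier -> 'rV[R]_n -> mf_carrier;
  chart_dom_open : forall p, open (chart_dom p);
  chart_dom_self : forall p, chart_dom p p;
  chart_img_open : forall p, open (chart p @` chart_dom p);
  chart_continuous :
    forall p q, chart_dom p q -> {for q, continuous (chart p)};
  chart_inv_continuous : forall p x, (chart p @` chart_dom p) x ->
    {for x, continuous (chart_inv p)};
  chartK : forall p q, chart_dom p q -> chart_inv p (chart p q) = q;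
  chart_transition : forall p q,
    smooth_on (chart p @` (chart_dom p `&` chart_dom q))
              (chart q \o chart_inv p)
}.

(* T_pM: a tangent vector at p is given by its coordinates in [chart p].  Its
   coordinates in another chart around p are [dirder (chart i) p v], see
   below. *)
Definition tangent (R : realType) (n : nat) (M : manifold R n) (p : M)
  : normedModType R := 'rV[R]_n.

Definition vector_field (R : realType) (n : nat) (M : manifold R n) : Type :=
  forall p : M, tangent p.

Definition section_along (R : realType) (n n' : nat) (M : manifold R n)
  (N : manifold R n') (phi : M -> N) : Type := forall p : M, tangent (phi p).

Definition smooth_near (R : realType) (n : nat) (M : manifold R n)
    (W : normedModType R) (f : M -> W) (p : M) : Prop :=
  exists2 U : set 'rV[R]_n, open_nbhs (chart p p) U &
    smooth_on U (f \o chart_inv p).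

(* The derivative v(f) of f at p in the direction of the tangent vector v. *)
Definition dirder (R : realType) (n : nat) (M : manifold R n)
    (W : normedModType R) (f : M -> W) (p : M) (v : tangent p) : W :=
  'D_(v : 'rV[R]_n) (f \o chart_inv p) (chart p p).

(* Near p, the coordinates of s(q) in the fixed chart around phi(p) depend
   smoothly on q. *)
Definition smooth_section (R : realType) (n n' : nat) (M : manifold R n)
    (N : manifold R n') (phi : M -> N) (s : section_along phi) (p : M) : Prop :=
  smooth_near (fun q => dirder (chart (phi p)) (s q)) p.

Definition smooth_field (R : realType) (n : nat) (M : manifold R n)
    (X : vector_field M) (p : M) : Prop :=
  smooth_section (phi := id) X p.

Definition smooth_map (R : realType) (n n' : nat) (M : manifold R n)
    (N : manifold R n') (phi : M -> N) : Prop :=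
  continuous phi /\ forall p, smooth_near (chart (phi p) \o phi) p.

Definition tangent_map (R : realType) (n n' : nat) (M : manifold R n)
    (N : manifold R n') (phi : M -> N) (p : M) (v : tangent p)
    : tangent (phi p) :=
  dirder (chart (phi p) \o phi) v.

Record riemannian (R : realType) (n : nat) := Riemannian {
  rm_manifold :> manifold R n;
  metric : forall p : rm_manifold, tangent p -> tangent p -> R;
  metric_linear : forall (p : rm_manifold) (a : R) (u v w : tangent p),
    metric (a *: u + v) w = a * metric u w + metric v w;
  metric_sym : forall (p : rm_manifold) (u v : tangent p),
    metric u v = metric v u;
  metric_pos : forall (p : rm_manifold) (v : tangent p),
    v != 0 -> 0 < metric v v;
  metric_smooth : forall (p : rm_manifold) (X Y : vector_field rm_manifold),
    smooth_field X p -> smooth_field Y p ->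
    smooth_near (fun q => metric (X q) (Y q) : R^o) p
}.

(* The parameter m is half of the real dimension. *)
Record almost_hermitian (R : realType) (m : nat) := AlmostHermitian {
  ah_riemannian :> riemannian R (m + m);
  acs : forall p : ah_riemannian, tangent p -> tangent p;
  acs_linear : forall (p : ah_riemannian) (a : R) (u v : tangent p),
    acs (a *: u + v) = a *: acs u + acs v;
  acs_square : forall (p : ah_riemannian) (v : tangent p), acs (acs v) = - v;
  acs_isometric : forall (p : ah_riemannian) (u v : tangent p),
    metric (acs u) (acs v) = metric u v;
  acs_smooth : forall (p : ah_riemannian) (X : vector_field ah_riemannian),
    smooth_field X p -> smooth_field (fun q => acs (X q)) p
}.

(* Connections on phi^{-1}TN; phi = id gives the connections on TM.  Sections
   and functions need only be smooth near the point where the derivative is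
   taken; multiplying by the indicator function of a neighbourhood, the Leibniz
   rule then forces [D p v s] to depend only on the germ of s at p. *)
Record is_connection (R : realType) (n n' : nat) (M : manifold R n)
    (N : manifold R n') (phi : M -> N)
    (D : forall p : M, tangent p -> section_along phi -> tangent (phi p))
    : Prop := IsConnection {
  connection_linear : forall (p : M) (a : R) (u v : tangent p)
      (s : section_along phi), smooth_section s p ->
    D p (a *: u + v) s = a *: D p u s + D p v s;
  connection_additive : forall (p : M) (v : tangent p)
      (s t : section_along phi), smooth_section s p -> smooth_section t p ->
    D p v (fun q => s q + t q) = D p v s + D p v t;
  connection_leibniz : forall (p : M) (v : tangent p) (f : M -> R^o)
      (s : section_along phi), smooth_near f p -> smooth_section s p ->
    D p v (fun q => (f q : R) *: s q)
      = (dirder f v : R) *: s p + (f p : R) *: D p v s;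
  connection_smooth : forall (p : M) (X : vector_field M)
      (s : section_along phi), smooth_field X p -> smooth_section s p ->
    smooth_section (fun q => D q (X q) s) p
}.

Definition torsion_free (R : realType) (n : nat) (M : manifold R n)
    (nabla : forall p : M, tangent p -> vector_field M -> tangent p) : Prop :=
  forall (p : M) (X Y : vector_field M) (f : M -> R^o),
    smooth_field X p -> smooth_field Y p -> smooth_near f p ->
    dirder f (nabla p (X p) Y - nabla p (Y p) X)
      = dirder (fun q => dirder f (Y q)) (X p)
        - dirder (fun q => dirder f (X q)) (Y p).

Definition metric_compatible (R : realType) (n : nat) (M : riemannian R n)
    (nabla : forall p : M, tangent p -> vector_field M -> tangent p) : Prop :=
  forall (p : M) (v : tangent p) (Y Z : vector_field M),
    smooth_field Y p -> smooth_field Z p ->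
    dirder (fun q => metric (Y q) (Z q) : R^o) v
      = metric (nabla p v Y) (Z p) + metric (Y p) (nabla p v Z).

Definition levi_civita (R : realType) (n : nat) (M : riemannian R n)
    (nabla : forall p : M, tangent p -> vector_field M -> tangent p) : Prop :=
  [/\ is_connection (phi := id) nabla, torsion_free nabla
    & metric_compatible nabla].

Definition pullback_connection (R : realType) (n n' : nat) (M : manifold R n)
    (N : manifold R n') (phi : M -> N)
    (nablaN : forall p : N, tangent p -> vector_field N -> tangent p)
    (D : forall p : M, tangent p -> section_along phi -> tangent (phi p))
    : Prop :=
  is_connection D /\
  forall (p : M) (v : tangent p) (Z : vector_field N),
    smooth_field Z (phi p) ->
    D p v (fun q => Z (phi q)) = nablaN (phi p) (tangent_map phi v) Z.

(* A local frame on some neighbourhood of p, given by fields on M whose values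
   far from p are irrelevant. *)
Definition orthonormal_frame (R : realType) (n : nat) (M : riemannian R n)
    (p : M) (e : 'I_n -> vector_field M) : Prop :=
  (forall i, smooth_field (e i) p) /\
  (\forall q \near p, forall i j, metric (e i q) (e j q) = (i == j)%:R).

(* The family e_1, ..., e_m, J e_1, ..., J e_m. *)
Definition J_family (R : realType) (m : nat) (M : almost_hermitian R m)
    (e : 'I_m -> vector_field M) (i : 'I_(m + m)) : vector_field M :=
  match fintype.split i with
  | inl k => e k
  | inr k => fun q => acs (e k q)
  end.

(* (nabla_v J)(Y) at p *)
Definition nabla_J (R : realType) (m : nat) (M : almost_hermitian R m)
    (nabla : forall p : M, tangent p -> vector_field M -> tangent p)
    (p : M) (v : tangent p) (Y : vector_field M) : tangent p :=
  nabla p v (fun q => acs (Y q)) - acs (nabla p v Y).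

(* The sum does not depend on the frame; any frame around p is selected. *)
Definition div_J (R : realType) (m : nat) (M : almost_hermitian R m)
    (nabla : forall p : M, tangent p -> vector_field M -> tangent p)
    : vector_field M := fun p =>
  xget 0 [set w : tangent p | exists2 e : 'I_m -> vector_field M,
    orthonormal_frame p (J_family e) &
    w = \sum_(k < m) (nabla_J nabla (e k p) (e k)
                      + nabla_J nabla (acs (e k p)) (fun q => acs (e k q)))].

Definition one_two_symplectic (R : realType) (m : nat)
    (N : almost_hermitian R m)
    (nabla : forall p : N, tangent p -> vector_field N -> tangent p) : Prop :=
  forall (p : N) (X Y : vector_field N),
    smooth_field X p -> smooth_field Y p ->
    nabla_J nabla (X p) Y
      + nabla_J nabla (acs (X p)) (fun q => acs (Y q)) = 0.

Definition holomorphic (R : realType) (m m' : nat) (M : almost_hermitian R m)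
    (N : almost_hermitian R m') (phi : M -> N) : Prop :=
  smooth_map phi /\
  forall (p : M) (v : tangent p),
    tangent_map phi (acs v) = acs (tangent_map phi v).

(* The sum does not depend on the frame; any frame around p is selected. *)
Definition tension_field (R : realType) (n n' : nat) (M : riemannian R n)
    (N : manifold R n') (phi : M -> N)
    (nabla : forall p : M, tangent p -> vector_field M -> tangent p)
    (D : forall p : M, tangent p -> section_along phi -> tangent (phi p))
    : section_along phi := fun p =>
  xget 0 [set w : tangent (phi p) | exists2 e : 'I_n -> vector_field M,
    orthonormal_frame p e &
    w = \sum_(j < n) (D p (e j p) (fun q => tangent_map phi (e j q))
                      - tangent_map phi (nabla p (e j p) (e j)))].

Definition harmonic_map (R : realType) (n n' : nat) (M : riemannian R n)
    (N : manifold R n') (phi : M -> N)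
    (nabla : forall p : M, tangent p -> vector_field M -> tangent p)
    (D : forall p : M, tangent p -> section_along phi -> tangent (phi p))
    : Prop :=
  forall p : M, tension_field nabla D p = 0.

(* Main.v *)
(* Since N is (1,2)-symplectic,
     (nabla_X J)(s) + (nabla_{JX} J)(J s) = 0
   for every section s of phi^{-1}TN; with s = dphi(X), phi being holomorphic,
   and the torsion-freeness of both connections, this reads
     J (nabla_X dphi(X) + nabla_{JX} dphi(JX)) = dphi(nabla_X JX - nabla_{JX} X).
   Summing over X = e_k and subtracting J dphi(nabla_X X + nabla_{JX} JX) gives
   J tau(phi) = dphi(delta J), hence dphi(J delta J) = - tau(phi).  The second
   fundamental form is tensorial, so tau(phi) may be computed in an adapted
   frame, and such frames exist by the Gram-Schmidt process. *)
Require Import Defs.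
From HB Require Import structures.
From mathcomp Require Import all_boot all_order all_algebra.
From mathcomp Require Import all_classical all_reals all_analysis.
From mathcomp Require Import ring.
Import Order.TTheory GRing.Theory Num.Theory.
Import numFieldNormedType.Exports.
Local Open Scope classical_set_scope.
Local Open Scope ring_scope.

Set Implicit Arguments.
Unset Strict Implicit.
Unset Printing Implicit Defensive.

(** * Differential calculus in normed modules *)

Section Differentiation.
Context {R : realType}.
Implicit Types V W : normedModType R.

(** The condition on $N$ concerns vector fields on $N$, whereas $d\phi(X)$ is only a section along
    $\phi$ and need not extend to a field on $N$. The bridge is local: near $p$, every such section
    is a combination of coordinate fields of $N$ composed with $\phi$, with coefficients that are
    functions on $M$. The Leibniz rule and the pull-back property then compute its derivative; in
    $\nabla J$ the terms that differentiate the coefficients cancel. The same expansion yields the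
    torsion formula along $\phi$, because coordinate fields commute. A tangent vector at $q$ is
    stored by its coordinates in the chart at $q$, so the coordinate system moves with the base
    point, while smoothness is tested in a fixed chart; the chain rule through transition maps links
    the two. Both [div_J] and [tension_field] rest on a chosen frame. The frame chosen for [div_J]
    is adapted to $J$, and frame independence moves the tension field to it. *)

Lemma near_eq_differentiable V W (f g : V -> W) (x : V) :
  (\forall y \near x, f y = g y) -> differentiable f x -> differentiable g x.
Proof.
move=> fg df.
have [dfc fE] := (diff_locallyP x f).1 df.
have gE : g \o shift x = cst (g x) + 'd f x +o_ 0 id.
  apply/eqaddoP => e e0.
  have /eqaddoP/(_ e e0) fe := fE.
  have fgx : \forall h \near 0, f (h + x) = g (h + x).
    by move: fg; rewrite (near_shift 0)/=; apply: filterS => y; rewrite /= subr0.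
  move: fe fgx; apply: filterS2 => h fh fgh.
  by move: fh; rewrite !fctE /= fgh (nbhs_singleton fg).
have dgf : 'd g x = 'd f x :> (V -> W) by exact: diff_unique.
by apply/diff_locallyP; rewrite dgf.
Qed.

(** Scaling is packed as a continuous bilinear map so that the differential of a bilinear map gives
    the product rule for a scalar function times a vector-valued one. *)
Lemma scale_bilinear W : exists2 B : {bilinear R^o -> W -> W},
  continuous (fun p => B p.1 p.2) & forall (a : R) (w : W), B a w = a *: w.
Proof.
have bl : bilinear_for (GRing.Scale.Law.clone _ _ *:%R _)
    (GRing.Scale.Law.clone _ _ *:%R _)
    (fun (a : R^o) (w : W) => (a : R) *: w).
  by split=> [u'|u] a y z /=; rewrite ?scalerDl ?scalerA// scalerDr !scalerA mulrC.
pose blM := bilinear_isBilinear.Build R R^o W W _ _ _ bl.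
pose B : {bilinear R^o -> W -> W} :=
  HB.pack (fun (a : R^o) (w : W) => (a : R) *: w) blM.
by exists B => // p; exact: scale_continuous.
Qed.

Lemma is_diff_scale V W (f : V -> R^o) (g : V -> W) x :
  differentiable f x -> differentiable g x ->
  is_diff x (fun y => (f y : R) *: g y)
    (fun v => ('d f x v : R) *: g x + (f x : R) *: 'd g x v).
Proof.
move=> df dg; have [B cB BE] := scale_bilinear W.
have dfg : differentiable (fun y => (f y, g y)) x.
  by apply: differentiable_pair.
have dB : differentiable (fun p => B p.1 p.2) (f x, g x).
  by apply: differentiable_bilin.
have -> : (fun y => (f y : R) *: g y) =
    (fun p => B p.1 p.2) \o (fun y => (f y, g y)).
  by apply/funext => y; rewrite /= BE.
apply: DiffDef; first exact: differentiable_comp.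
rewrite diff_comp// diff_bilin//; apply/funext => v.
by rewrite /= !BE diff_pair//= addrC.
Qed.

Lemma differentiable_scale V W (f : V -> R^o) (g : V -> W) x :
  differentiable f x -> differentiable g x ->
  differentiable (fun y => (f y : R) *: g y) x.
Proof. by move=> df dg; have [] := is_diff_scale df dg. Qed.

Lemma derive_scale V W (f : V -> R^o) (g : V -> W) x v :
  differentiable f x -> differentiable g x ->
  'D_v (fun y => (f y : R) *: g y) x =
    ('D_v f x : R) *: g x + (f x : R) *: 'D_v g x.
Proof.
move=> df dg; have [dfg fgE] := is_diff_scale df dg.
by rewrite !deriveE// fgE.
Qed.

Lemma derive_comp V V' W (f : V -> V') (g : V' -> W) x v :
  differentiable f x -> differentiable g (f x) ->
  'D_v (g \o f) x = 'D_('D_v f x) g (f x).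
Proof.
move=> df dg; have dgf := differentiable_comp df dg.
by rewrite (deriveE _ dgf) (deriveE _ df) (deriveE _ dg) diff_comp.
Qed.

Lemma deriveP_dir V W (f : V -> W) x a u v : differentiable f x ->
  'D_(a *: u + v) f x = a *: 'D_u f x + 'D_v f x.
Proof. by move=> df; rewrite !deriveE// linearP. Qed.

Lemma derive_sum_dir V W (f : V -> W) x (I : finType) (u : I -> V) :
  differentiable f x -> 'D_(\sum_i u i) f x = \sum_i 'D_(u i) f x.
Proof.
move=> df; rewrite deriveE// linear_sum.
by apply: eq_bigr => i _; rewrite deriveE.
Qed.

Lemma derive_coord_dir n W (f : 'rV[R]_n -> W) x (v : 'rV[R]_n) :
  differentiable f x ->
  'D_v f x = \sum_j v 0 j *: 'D_(delta_mx 0 j) f x.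
Proof.
move=> df; rewrite {1}(row_sum_delta v) derive_sum_dir//.
by apply: eq_bigr => j _; rewrite deriveE// linearZ deriveE.
Qed.

Lemma derive_rV V n (f : V -> 'rV[R]_n) x v i : differentiable f x ->
  ('D_v f x) 0 i = 'D_v (fun y => f y 0 i : R^o) x.
Proof.
by move=> df; rewrite derive_mx ?mxE//; exact: diff_derivable.
Qed.

Lemma differentiable_rV V n (f : V -> 'rV[R]_n) x :
  differentiable f x <-> forall i, differentiable (fun y => f y 0 i : R^o) x.
Proof.
split=> [df i|df].
  apply: (@differentiable_comp _ _ _ _ f (fun w : 'rV[R]_n => w 0 i : R^o)) => //.
  exact: differentiable_coord.
have -> : f = \sum_i (fun y => (f y 0 i : R) *: (delta_mx 0 i : 'rV[R]_n)).
  by apply/funext => y; rewrite fct_sumE; exact: row_sum_delta.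
by apply: differentiable_sum => i; exact: differentiableZl.
Qed.

(** * Stability of $C^k$ functions on an open set *)

Section CkOpen.
Variables (V : normedModType R) (U : set V).
Hypothesis oU : open U.

Lemma near_open x (P : V -> Prop) : U x -> (forall y, U y -> P y) ->
  \forall y \near x, P y.
Proof. by move=> Ux UP; apply: filterS (open_nbhs_nbhs (conj oU Ux)). Qed.

(** Derivatives are taken in the ambient space, so agreement on [U] passes to them because [U] is
    open. *)
Lemma Ck_on_ext W k (f g : V -> W) : (forall y, U y -> f y = g y) ->
  Ck_on k U f -> Ck_on k U g.
Proof.
elim: k f g => [|k IH] f g fg /=.
  move=> cf x Ux; have fgx := near_open Ux fg.
  have -> : {for x, continuous g} = (g @ x --> f x) by rewrite /continuous_at fg.
  by apply: cvg_trans (cf x Ux); exact: near_eq_cvg.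
move=> [df Cf]; split=> [x Ux|v].
  by apply: near_eq_differentiable (df x Ux); exact: near_open.
apply: IH (Cf v) => y Uy; apply: near_eq_derive; exact: near_open.
Qed.

Lemma Ck_on_continuous W k (f : V -> W) : Ck_on k U f ->
  forall x, U x -> {for x, continuous f}.
Proof.
by case: k => //= k [df _] x Ux; exact/differentiable_continuous/df.
Qed.

Lemma Ck_on_pred W k (f : V -> W) : Ck_on k.+1 U f -> Ck_on k U f.
Proof.
elim: k f => [|k IH] f; first by move=> Cf x; exact: Ck_on_continuous Cf x.
by move=> [df Cf]; split=> // v; exact: IH.
Qed.

Lemma Ck_on_cst W k (w : W) : Ck_on k U (cst w).
Proof.
elim: k w => [|k IH] w /=; first by move=> x _; exact: cvg_cst.
split=> // v; suff -> : (fun x : V => 'D_v (cst w) x) = cst 0 by [].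
by apply/funext => x; rewrite derive_cst.
Qed.

Lemma Ck_onD W k (f g : V -> W) : Ck_on k U f -> Ck_on k U g ->
  Ck_on k U (f \+ g).
Proof.
elim: k f g => [|k IH] f g /=.
  by move=> cf cg x Ux; apply: continuousD; [exact: cf|exact: cg].
move=> [df Cf] [dg Cg]; split=> [x Ux|v].
  by apply: differentiableD; [exact: df|exact: dg].
apply: Ck_on_ext (IH _ _ (Cf v) (Cg v)) => x Ux.
by rewrite deriveD//; apply: diff_derivable; [exact: df|exact: dg].
Qed.

Lemma Ck_on_scale W k (f : V -> R^o) (g : V -> W) :
  Ck_on k U f -> Ck_on k U g -> Ck_on k U (fun x => (f x : R) *: g x).
Proof.
elim: k f g => [|k IH] f g.
  by move=> cf cg x Ux; apply: (@cvgZ _ _ _ _ _ f g); [exact: cf|exact: cg].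
move=> Cf Cg; have [df Df] := Cf; have [dg Dg] := Cg.
split=> [x Ux|v]; first by apply: differentiable_scale; [exact: df|exact: dg].
apply: (@Ck_on_ext _ _ ((fun x => ('D_v f x : R) *: g x) \+ (fun x => (f x : R) *: 'D_v g x))).
  by move=> x Ux; rewrite derive_scale//; [exact: df|exact: dg].
apply: Ck_onD; apply: IH.
- exact: Df.
- exact: Ck_on_pred.
- exact: Ck_on_pred.
- exact: Dg.
Qed.

Lemma Ck_on_sum W k (I : finType) (f : I -> V -> W) :
  (forall i, Ck_on k U (f i)) -> Ck_on k U (fun x => \sum_i f i x).
Proof.
move=> Cf; pose P (g : V -> W) := Ck_on k U g.
have : P (\sum_i f i).
  by apply: big_ind => [|g h|i _]; [exact: Ck_on_cst|exact: Ck_onD|exact: Cf].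
by apply: Ck_on_ext => x _; rewrite fct_sumE.
Qed.

Lemma Ck_on_coord n k (f : V -> 'rV[R]_n) i : Ck_on k U f ->
  Ck_on k U (fun x => f x 0 i : R^o).
Proof.
elim: k f => [|k IH] f /=.
  move=> cf x Ux; apply: (@continuous_comp _ _ _ f (fun w : 'rV[R]_n => w 0 i : R^o)).
    exact: cf.
  exact: coord_continuous.
move=> [df Df]; split=> [x Ux|v]; first by have /differentiable_rV := df x Ux; exact.
by apply: Ck_on_ext (IH _ (Df v)) => x Ux; rewrite derive_rV//; exact: df.
Qed.

(** [Ck_on] differentiates in fixed directions only. A direction that varies with the point is split
    along the standard basis, hence the finite-dimensional source of [f]. *)
Lemma Ck_on_derive_dir n W k (f : 'rV[R]_n -> W) (g : V -> 'rV[R]_n) (h : V -> 'rV[R]_n) :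
  (forall j, Ck_on k U (fun x => 'D_(delta_mx 0 j) f (h x))) ->
  (forall x, U x -> differentiable f (h x)) ->
  Ck_on k U g -> Ck_on k U (fun x => 'D_(g x) f (h x)).
Proof.
move=> Cf df Cg.
apply: (@Ck_on_ext _ _ (fun x => \sum_j (g x 0 j : R) *: 'D_(delta_mx 0 j) f (h x))).
  by move=> x Ux; rewrite derive_coord_dir//; exact: df.
by apply: Ck_on_sum => j; apply: Ck_on_scale; [exact: Ck_on_coord|exact: Cf].
Qed.

(** The induction generalizes over [g]: by the chain rule, the derivative of the composite is a sum
    of coordinates of ['D_v f] times partial derivatives of [g] composed with [f], and the latter
    fall under the induction hypothesis. *)
Lemma Ck_on_comp n W k (f : V -> 'rV[R]_n) (g : 'rV[R]_n -> W) (U' : set 'rV[R]_n) :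
  (forall x, U x -> U' (f x)) -> Ck_on k U f -> Ck_on k U' g -> Ck_on k U (g \o f).
Proof.
move=> fU; elim: k g => [|k IH] g.
  by move=> cf cg x Ux; apply: continuous_comp; [exact: cf|exact/cg/fU].
move=> Cf Cg; have [df Df] := Cf; have [dg Dg] := Cg.
have Cf' := Ck_on_pred Cf.
split=> [x Ux|v].
  by apply: differentiable_comp; [exact: df|exact/dg/fU].
apply: (@Ck_on_ext _ _ (fun x => 'D_('D_v f x) g (f x))).
  by move=> x Ux; apply/esym/derive_comp; [exact: df|exact/dg/fU].
apply: Ck_on_derive_dir; last exact: Df.
  by move=> j; exact: (IH _ Cf' (Dg _)).
by move=> x Ux; exact/dg/fU.
Qed.

(** The derivative of $f^{-1/2}$ is $-\frac12 (f^{-1/2})^3 Df$, a product of copies of the function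
    itself and of $Df$, so the induction closes on this single function. It serves to normalize
    vectors. *)
Lemma Ck_on_invsqrt k (f : V -> R^o) : (forall x, U x -> 0 < (f x : R)) ->
  Ck_on k U f -> Ck_on k U (fun x => (Num.sqrt (f x))^-1 : R^o).
Proof.
move=> f0; elim: k => [|k IH] Cf.
  move=> x Ux; apply: (@cvgV _ _ _ _ (fun x => Num.sqrt (f x))).
    by rewrite gt_eqF// sqrtr_gt0 f0.
  apply: (@continuous_comp _ _ _ f Num.sqrt); first exact: Cf.
  exact: sqrt_continuous.
have [df Df] := Cf.
have sq x : U x -> 'D_1 Num.sqrt (f x : R) = (2 * Num.sqrt (f x))^-1 :> R /\
    differentiable (Num.sqrt : R^o -> R^o) (f x).
  move=> Ux; have [der val] := is_derive1_sqrt (f0 _ Ux); split=> //.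
  by apply/derivable1_diffP.
have ds x : U x -> differentiable (fun y => Num.sqrt (f y) : R^o) x.
  move=> Ux; apply: (@differentiable_comp _ _ _ _ f (Num.sqrt : R^o -> R^o)).
    exact: df.
  by have [] := sq x Ux.
have s0 x : U x -> Num.sqrt (f x) != 0 by move=> Ux; rewrite gt_eqF// sqrtr_gt0 f0.
have dv x : U x -> differentiable (fun y => (Num.sqrt (f y))^-1 : R^o) x.
  by move=> Ux; apply: differentiableV; [exact: ds|exact: s0].
split => // v.
apply: (@Ck_on_ext _ _ (fun x => (- 2^-1 * (Num.sqrt (f x))^-1) *:
  (((Num.sqrt (f x))^-1 : R) *: (((Num.sqrt (f x))^-1 : R) *: 'D_v f x)) : R^o)).
  move=> x Ux; rewrite deriveV; last 2 first.
  - exact: s0.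
  - exact/diff_derivable/ds.
  have -> : 'D_v (fun y => Num.sqrt (f y)) x = 'D_v f x * 'D_1 Num.sqrt (f x : R).
    have [_ dsq] := sq x Ux.
    rewrite (@derive_comp _ _ _ f (Num.sqrt : R^o -> R^o) x v (df x Ux) dsq).
    rewrite (deriveE _ dsq) (deriveE _ dsq).
    by rewrite -{1}['D_v f x]mulr1 -[_ * 1]/(_ *: (1 : R^o)) linearZ.
  have [-> _] := sq x Ux.
  rewrite /GRing.scale /=; field; exact: s0.
have Cf' := Ck_on_pred Cf.
apply: Ck_on_scale; last by do !apply: Ck_on_scale; [exact: IH|exact: IH|exact: Df].
by apply: (@Ck_on_scale _ _ (cst (- 2^-1 : R^o))); [exact: Ck_on_cst|exact: IH].
Qed.

End CkOpen.
End Differentiation.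

(** * Germs of smooth functions and charts *)

(** [smooth_near f p] unfolds to this property of [f] read in the chart at [p], so closure
    properties of germs transfer by conversion. *)
Definition smooth_at (R : realType) (V W : normedModType R) (f : V -> W) (x : V) :=
  exists2 U : set V, open_nbhs x U & smooth_on U f.

Section SmoothAt.
Context {R : realType}.
Implicit Types V W : normedModType R.

Lemma nbhs_open_sub V (x : V) (A : set V) : nbhs x A ->
  exists2 U : set V, open_nbhs x U & U `<=` A.
Proof. by rewrite nbhsE. Qed.

Lemma Ck_onS V W k (U U' : set V) (f : V -> W) :
  U `<=` U' -> Ck_on k U' f -> Ck_on k U f.
Proof.
move=> UU'; elim: k f => [|k IH] f /=; first by move=> cf x /UU'; exact: cf.
by move=> [df Df]; split=> [x /UU'|v]; [exact: df|exact: IH (Df v)].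
Qed.

Lemma smooth_at_lift V W W1 W2 (f : V -> W) (g : V -> W1) (h : V -> W2) (x : V) :
  (forall k (U : set V), open U -> Ck_on k U f -> Ck_on k U g -> Ck_on k U h) ->
  smooth_at f x -> smooth_at g x -> smooth_at h x.
Proof.
move=> H [U [oU Ux] sf] [U' [oU' U'x] sg].
have oUU' : open (U `&` U') by exact: openI.
exists (U `&` U') => // k; apply: H => //.
  exact: Ck_onS (sf k).
exact: Ck_onS (sg k).
Qed.

Lemma smooth_at_nbhs V W (f : V -> W) (A : set V) x :
  nbhs x A -> smooth_on A f -> smooth_at f x.
Proof.
move=> /nbhs_open_sub[U Ux UA] sf; exists U => // k.
exact: Ck_onS (sf k).
Qed.

Lemma smooth_at_ext V W (f g : V -> W) x : (\forall y \near x, f y = g y) ->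
  smooth_at f x -> smooth_at g x.
Proof.
move=> /nbhs_open_sub[U [oU Ux] fg] [U' [oU' U'x] sf].
have oUU' : open (U `&` U') by exact: openI.
exists (U `&` U') => // k; apply: Ck_on_ext (Ck_onS _ (sf k)) => //.
by move=> y [Uy _]; exact: fg.
Qed.

Lemma smooth_at_cst V W (w : W) (x : V) : smooth_at (cst w) x.
Proof. by exists setT; [exact: open_nbhsT|move=> k; exact: Ck_on_cst]. Qed.

Lemma smooth_atD V W (f g : V -> W) x :
  smooth_at f x -> smooth_at g x -> smooth_at (f \+ g) x.
Proof. by apply: smooth_at_lift => k U oU; exact: Ck_onD. Qed.

Lemma smooth_at_scale V W (f : V -> R^o) (g : V -> W) x :
  smooth_at f x -> smooth_at g x -> smooth_at (fun y => (f y : R) *: g y) x.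
Proof. by apply: smooth_at_lift => k U oU; exact: Ck_on_scale. Qed.

Lemma smooth_at_coord V n (f : V -> 'rV[R]_n) x i :
  smooth_at f x -> smooth_at (fun y => f y 0 i : R^o) x.
Proof. by move=> [U xU sf]; exists U => // k; apply: Ck_on_coord (sf k); case: xU. Qed.

Lemma smooth_at_derive_dir n W (f : 'rV[R]_n -> W) (g : 'rV[R]_n -> 'rV[R]_n) x :
  smooth_at f x -> smooth_at g x -> smooth_at (fun y => 'D_(g y) f y) x.
Proof.
move=> [U [oU Ux] sf] [U' [oU' U'x] sg].
have oUU' : open (U `&` U') by exact: openI.
exists (U `&` U') => // k.
have [df Df] := sf k.+1.
apply: (@Ck_on_derive_dir _ _ _ oUU' _ _ _ f g id).
- by move=> j; exact: Ck_onS (Df _).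
- by move=> y [Uy _]; exact: df.
- exact: Ck_onS (sg k).
Qed.

Lemma smooth_at_differentiable V W (f : V -> W) x : smooth_at f x ->
  \forall y \near x, differentiable f y.
Proof.
by move=> [U Ux sf]; apply: filterS (open_nbhs_nbhs Ux); have [] := sf 1%N.
Qed.

Lemma smooth_at_comp V n W (f : V -> 'rV[R]_n) (g : 'rV[R]_n -> W) x :
  smooth_at f x -> smooth_at g (f x) -> smooth_at (g \o f) x.
Proof.
move=> [U [oU Ux] sf] [U' U'x sg].
have cf : {for x, continuous f} by exact: sf 0%N x Ux.
have /nbhs_open_sub[U'' [oU'' U''x] fU'] := cf _ (open_nbhs_nbhs U'x).
have oU3 : open (U `&` U'') by exact: openI.
exists (U `&` U'') => // k.
apply: (@Ck_on_comp _ _ _ oU3 _ _ _ f g U') (Ck_onS _ (sf k)) (sg k) => //.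
by move=> y [_ /fU'].
Qed.

Lemma smooth_at_invsqrt V (f : V -> R^o) x : 0 < (f x : R) -> smooth_at f x ->
  smooth_at (fun y => (Num.sqrt (f y))^-1 : R^o) x.
Proof.
move=> f0 [U [oU Ux] sf].
have cf : {for x, continuous f} by exact: sf 0%N x Ux.
have : \forall y \near x, 0 < (f y : R) by exact: (cvgr_gt (f x : R) cf).
move=> /nbhs_open_sub[U' [oU' U'x] f0'].
have oUU' : open (U `&` U') by exact: openI.
exists (U `&` U') => // k.
apply: (Ck_on_invsqrt oUU'); first by move=> y [_]; exact: f0'.
exact: Ck_onS (sf k).
Qed.

End SmoothAt.

(** * Changes of charts and coordinate vector fields *)

Section Charts.
Context {R : realType} {n : nat} {M : manifold R n}.
Implicit Types (W : normedModType R) (c p q : M).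

Lemma near_chart_dom c q : chart_dom c q -> \forall q' \near q, chart_dom c q'.
Proof. by move=> cq; apply: open_nbhs_nbhs; split=> //; exact: chart_dom_open. Qed.

Lemma near_chart c q (P : 'rV[R]_n -> Prop) : chart_dom c q ->
  (\forall x \near chart c q, P x) -> \forall q' \near q, P (chart c q').
Proof. by move=> cq Px; have := chart_continuous cq; apply. Qed.

Lemma near_chart_inv c q (P : M -> Prop) : chart_dom c q ->
  (\forall q' \near q, P q') -> \forall x \near chart c q, P (chart_inv c x).
Proof.
move=> cq Pq; have ci : (chart c @` chart_dom c) (chart c q) by exists q.
by have := chart_inv_continuous ci; apply; rewrite /= chartK.
Qed.

Lemma near_chart_invK c q : chart_dom c q ->
  \forall x \near chart c q, chart c (chart_inv c x) = x.
Proof.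
move=> cq; have : nbhs (chart c q) (chart c @` chart_dom c).
  by apply: open_nbhs_nbhs; split; [exact: chart_img_open|exists q].
by apply: filterS => _ [q' cq' <-]; rewrite chartK.
Qed.

Lemma smooth_at_transition c c' q : chart_dom c q -> chart_dom c' q ->
  smooth_at (chart c' \o chart_inv c) (chart c q).
Proof.
move=> cq cq'; apply: (@smooth_at_nbhs _ _ _ _ (chart c @` (chart_dom c `&` chart_dom c'))); last first.
  exact: chart_transition.
have dcc : \forall q' \near q, chart_dom c q' /\ chart_dom c' q'.
  by apply: filterI; exact: near_chart_dom.
apply: filterS2 (near_chart_invK cq) (near_chart_inv cq dcc) => x xK dx.
by exists (chart_inv c x).
Qed.

Lemma differentiable_transition c c' q : chart_dom c q -> chart_dom c' q ->
  differentiable (chart c' \o chart_inv c) (chart c q).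
Proof.
by move=> cq cq'; exact: nbhs_singleton (smooth_at_differentiable (smooth_at_transition cq cq')).
Qed.

Lemma chart_changeE W c c' q (f : M -> W) : chart_dom c q -> chart_dom c' q ->
  \forall x \near chart c q,
    ((f \o chart_inv c') \o (chart c' \o chart_inv c)) x = (f \o chart_inv c) x.
Proof.
move=> cq cq'; have := near_chart_inv cq (near_chart_dom cq').
by apply: filterS => x cx /=; rewrite chartK.
Qed.

Lemma differentiable_chart_change W c c' q (f : M -> W) :
  chart_dom c q -> chart_dom c' q ->
  differentiable (f \o chart_inv c') (chart c' q) ->
  differentiable (f \o chart_inv c) (chart c q).
Proof.
move=> cq cq' df; apply: near_eq_differentiable (chart_changeE f cq cq') _.
apply: differentiable_comp; first exact: differentiable_transition.
by rewrite /= chartK.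
Qed.

Lemma derive_chart_change W c c' q (f : M -> W) v :
  chart_dom c q -> chart_dom c' q ->
  differentiable (f \o chart_inv c') (chart c' q) ->
  'D_v (f \o chart_inv c) (chart c q) =
  'D_('D_v (chart c' \o chart_inv c) (chart c q)) (f \o chart_inv c') (chart c' q).
Proof.
move=> cq cq' df; rewrite -(near_eq_derive _ (chart_changeE f cq cq')).
rewrite derive_comp; last 2 first.
- exact: differentiable_transition.
- by rewrite /= chartK.
by rewrite /= chartK.
Qed.

Lemma derive_chart_self c q v : chart_dom c q ->
  'D_v (chart c \o chart_inv c) (chart c q) = v.
Proof.
move=> cq; rewrite -[RHS](derive_id (chart c q)).
apply: near_eq_derive; exact: near_chart_invK.
Qed.

Lemma dirder_chart_change W c q (f : M -> W) (v : tangent q) : chart_dom c q ->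
  differentiable (f \o chart_inv c) (chart c q) ->
  dirder f v = 'D_(dirder (chart c) v) (f \o chart_inv c) (chart c q).
Proof. by move=> cq df; apply: derive_chart_change => //; exact: chart_dom_self. Qed.

(** The tangent vector at [q] with coordinates [xi] in the chart at [c], converted to the chart at
    [q]. For fixed [xi], it is the field with constant coordinates in the chart at [c]; the basis
    vectors give the coordinate fields. *)
Definition tvec c q (xi : 'rV[R]_n) : tangent q :=
  'D_xi (chart q \o chart_inv c) (chart c q).

Lemma tvecK c q (xi : 'rV[R]_n) : chart_dom c q -> dirder (chart c) (tvec c q xi) = xi.
Proof.
move=> cq; rewrite -[RHS](derive_chart_self xi cq) /dirder /tvec.
rewrite [RHS](@derive_chart_change _ _ q)//; first exact: chart_dom_self.
by apply: differentiable_transition => //; exact: chart_dom_self.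
Qed.

Lemma dirderK c q (v : tangent q) : chart_dom c q -> tvec c q (dirder (chart c) v) = v.
Proof.
move=> cq; have qq := chart_dom_self q; rewrite -[RHS](derive_chart_self v qq).
rewrite /dirder /tvec [RHS](@derive_chart_change _ _ c)//.
exact: differentiable_transition.
Qed.

Lemma dirder_chart_self q (v : tangent q) : dirder (chart q) v = v.
Proof. exact/derive_chart_self/chart_dom_self. Qed.

Lemma tvec_self q (xi : 'rV[R]_n) : tvec q q xi = xi.
Proof. exact/derive_chart_self/chart_dom_self. Qed.

(** Differentiability at the single point [q], in the chart used by [dirder] there; this is what
    makes [dirder f] linear in the direction. *)
Definition differentiable_near W (f : M -> W) q :=
  differentiable (f \o chart_inv q) (chart q q).

Lemma dirderP W (f : M -> W) q (a : R) (u v : tangent q) :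
  differentiable_near f q -> dirder f (a *: u + v) = a *: dirder f u + dirder f v.
Proof. exact: deriveP_dir. Qed.

Lemma differentiable_near_chart c q : chart_dom c q -> differentiable_near (chart c) q.
Proof. by move=> cq; apply: differentiable_transition => //; exact: chart_dom_self. Qed.

Lemma tvec_sum c q (I : finType) (a : I -> R) (xi : I -> 'rV[R]_n) : chart_dom c q ->
  tvec c q (\sum_i a i *: xi i) = \sum_i a i *: tvec c q (xi i).
Proof.
move=> cq; have df : differentiable (chart q \o chart_inv c) (chart c q).
  by apply: differentiable_transition => //; exact: chart_dom_self.
rewrite /tvec derive_sum_dir//; apply: eq_bigr => i _.
by rewrite deriveE// linearZ -deriveE.
Qed.

Lemma near_eq_dirder W (f g : M -> W) q (v : tangent q) :
  (\forall q' \near q, f q' = g q') -> dirder f v = dirder g v.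
Proof.
move=> fg; apply: near_eq_derive.
exact: near_chart_inv (chart_dom_self q) fg.
Qed.

Lemma dirder_cst W (w : W) q (v : tangent q) : dirder (cst w) v = 0.
Proof. exact: derive_cst. Qed.

End Charts.

(** * Smooth functions and sections on manifolds *)

Section SmoothNear.
Context {R : realType} {n : nat} {M : manifold R n}.
Implicit Types (W : normedModType R) (p q : M).

Lemma smooth_near_ext W (f g : M -> W) p : (\forall q \near p, f q = g q) ->
  smooth_near f p -> smooth_near g p.
Proof. by move=> fg; apply: smooth_at_ext; exact: near_chart_inv (chart_dom_self p) fg. Qed.

Lemma smooth_near_cst W (w : W) p : smooth_near (cst w) p.
Proof. exact: smooth_at_cst. Qed.

Lemma smooth_nearD W (f g : M -> W) p :
  smooth_near f p -> smooth_near g p -> smooth_near (fun q => f q + g q) p.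
Proof. exact: smooth_atD. Qed.

Lemma smooth_near_scale W (f : M -> R^o) (g : M -> W) p :
  smooth_near f p -> smooth_near g p -> smooth_near (fun q => (f q : R) *: g q) p.
Proof. exact: smooth_at_scale. Qed.

Lemma smooth_near_coord m (f : M -> 'rV[R]_m) p i :
  smooth_near f p -> smooth_near (fun q => f q 0 i : R^o) p.
Proof. exact: smooth_at_coord. Qed.

Lemma smooth_near_invsqrt (f : M -> R^o) p : 0 < (f p : R) -> smooth_near f p ->
  smooth_near (fun q => (Num.sqrt (f q))^-1 : R^o) p.
Proof.
move=> f0; apply: (@smooth_at_invsqrt _ _ (f \o chart_inv p)).
by rewrite /= chartK//; exact: chart_dom_self.
Qed.

Lemma smooth_near_chart p : smooth_near (chart p) p.
Proof. exact: smooth_at_transition (chart_dom_self p) (chart_dom_self p). Qed.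

Lemma smooth_near_differentiable W (f : M -> W) p : smooth_near f p ->
  \forall q \near p, differentiable (f \o chart_inv p) (chart p q).
Proof. by move/smooth_at_differentiable/(near_chart (chart_dom_self p)). Qed.

Lemma smooth_near_differentiable_near W (f : M -> W) p : smooth_near f p ->
  \forall q \near p, differentiable_near f q.
Proof.
move=> sf; have dp := near_chart_dom (chart_dom_self p).
apply: filterS2 dp (smooth_near_differentiable sf) => q pq df.
exact: differentiable_chart_change (chart_dom_self q) pq df.
Qed.

(** Each [dirder f (X q)] is taken in the chart at [q]. Rewritten in the chart at [p], it becomes
    the derivative of one fixed function in the direction of the coordinates of [X], which vary
    smoothly by hypothesis. *)
Lemma smooth_near_dirder W (f : M -> W) (X : vector_field M) p :
  smooth_near f p -> smooth_field X p -> smooth_near (fun q => dirder f (X q)) p.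
Proof.
move=> sf sX; have pp := chart_dom_self p.
apply: smooth_at_ext (smooth_at_derive_dir sf sX).
have dp := near_chart_inv pp (near_chart_dom pp).
have sfp := smooth_at_differentiable sf.
apply: filterS3 dp (near_chart_invK pp) sfp => x px xK df.
have df' : differentiable (f \o chart_inv p) (chart p (chart_inv p x)) by rewrite xK.
by rewrite [RHS](dirder_chart_change (X (chart_inv p x)) px df') xK.
Qed.

Lemma smooth_near_continuous (f : M -> R^o) p : smooth_near f p ->
  {for p, continuous f}.
Proof.
move=> [U Up sf]; have cf := sf 0%N _ (proj2 Up).
have pp := chart_dom_self p.
have fE : \forall q \near p, (f \o chart_inv p) (chart p q) = f q.
  by apply: filterS (near_chart_dom pp) => q pq /=; rewrite chartK.
have : (f \o chart_inv p) (chart p q) @[q --> p] --> (f p : R^o).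
  move=> A fA.
  apply: (@near_chart _ _ _ p p (fun x => A ((f \o chart_inv p) x))) => //.
  by apply: cf; rewrite /= chartK.
by apply: cvg_trans; apply: near_eq_cvg; apply: filterS fE => q ->.
Qed.

End SmoothNear.

(** * Smooth maps and sections along them *)

Section SmoothMap.
Context {R : realType} {n n' : nat} {M : manifold R n} {N : manifold R n'}.
Variable phi : M -> N.
Hypothesis smooth_phi : smooth_map phi.
Implicit Types (W : normedModType R) (p q : M) (s t : section_along phi).

Lemma near_map p (P : N -> Prop) : (\forall y \near phi p, P y) ->
  \forall q \near p, P (phi q).
Proof. by have [cphi _] := smooth_phi; exact: cphi. Qed.

Lemma near_map_dom p : \forall q \near p, chart_dom (phi p) (phi q).
Proof. exact: near_map (near_chart_dom (chart_dom_self _)). Qed.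

Lemma map_chartE W (f : N -> W) p : \forall x \near chart p p,
  ((f \o chart_inv (phi p)) \o ((chart (phi p) \o phi) \o chart_inv p)) x =
  ((f \o phi) \o chart_inv p) x.
Proof.
have := near_chart_inv (chart_dom_self p) (near_map_dom p).
by apply: filterS => x dx /=; rewrite chartK.
Qed.

Lemma smooth_near_comp W (f : N -> W) p :
  smooth_near f (phi p) -> smooth_near (f \o phi) p.
Proof.
move=> sf; apply: smooth_at_ext (map_chartE f p) _.
apply: smooth_at_comp; first by have [_] := smooth_phi; exact.
by rewrite /= chartK//; exact: chart_dom_self.
Qed.

Lemma differentiable_near_map p : differentiable_near (chart (phi p) \o phi) p.
Proof.
have [_ /(_ p)/smooth_near_differentiable_near] := smooth_phi.
exact: nbhs_singleton.
Qed.

Lemma tangent_mapP p (a : R) (u v : tangent p) :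
  tangent_map phi (a *: u + v) = a *: tangent_map phi u + tangent_map phi v.
Proof. exact: dirderP (differentiable_near_map p). Qed.

Lemma tangent_mapD p (u v : tangent p) :
  tangent_map phi (u + v) = tangent_map phi u + tangent_map phi v.
Proof. by have := tangent_mapP 1 u v; rewrite !scale1r. Qed.

Lemma tangent_mapZ p (a : R) (u : tangent p) :
  tangent_map phi (a *: u) = a *: tangent_map phi u.
Proof.
have := tangent_mapP a u 0; rewrite addr0 => ->.
by rewrite [X in _ + X](derive0 _ _) addr0.
Qed.

Lemma tangent_mapN p (u : tangent p) : tangent_map phi (- u) = - tangent_map phi u.
Proof. by rewrite -scaleN1r tangent_mapZ scaleN1r. Qed.

Lemma tangent_mapB p (u v : tangent p) :
  tangent_map phi (u - v) = tangent_map phi u - tangent_map phi v.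
Proof. by rewrite tangent_mapD tangent_mapN. Qed.

Lemma tangent_map_sum p (I : Type) (r : seq I) (u : I -> tangent p) :
  tangent_map phi (\sum_(i <- r) u i) = \sum_(i <- r) tangent_map phi (u i).
Proof.
elim: r => [|i r IH]; last by rewrite !big_cons tangent_mapD IH.
by rewrite !big_nil; exact: derive0.
Qed.

Lemma dirder_tangent_map W (f : N -> W) p (v : tangent p) :
  differentiable_near f (phi p) -> dirder f (tangent_map phi v) = dirder (f \o phi) v.
Proof.
move=> df; rewrite /tangent_map /dirder -(near_eq_derive _ (map_chartE f p)).
rewrite derive_comp; last 2 first.
- exact: differentiable_near_map.
- by rewrite /= chartK//; exact: chart_dom_self.
by rewrite /= chartK//; exact: chart_dom_self.
Qed.

Lemma smooth_section_ext s t p : (\forall q \near p, s q = t q) ->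
  smooth_section s p -> smooth_section t p.
Proof. by move=> st; apply: smooth_near_ext; apply: filterS st => q ->. Qed.

Lemma smooth_section_scaleD (f : M -> R^o) s t p :
  smooth_near f p -> smooth_section s p -> smooth_section t p ->
  smooth_section (fun q => (f q : R) *: s q + t q) p.
Proof.
move=> sf ss st.
apply: smooth_near_ext (smooth_nearD (smooth_near_scale sf ss) st).
apply: filterS (near_map_dom p) => q dq.
by rewrite dirderP//; exact: differentiable_near_chart.
Qed.

Lemma smooth_section0 p : smooth_section (fun q : M => 0 : tangent (phi q)) p.
Proof.
apply: smooth_near_ext (smooth_near_cst 0 p).
by apply: nearW => q; rewrite /dirder derive0.
Qed.

Lemma smooth_section_scale (f : M -> R^o) s p :
  smooth_near f p -> smooth_section s p ->
  smooth_section (fun q => (f q : R) *: s q) p.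
Proof.
move=> sf ss; have := smooth_section_scaleD sf ss (smooth_section0 p).
by apply: smooth_section_ext; apply: nearW => q; rewrite addr0.
Qed.

Lemma smooth_section_sum (I : Type) (r : seq I) (f : I -> M -> R^o)
    (s : I -> section_along phi) p :
  (forall i, smooth_near (f i) p) -> (forall i, smooth_section (s i) p) ->
  smooth_section (fun q => \sum_(i <- r) (f i q : R) *: s i q) p.
Proof.
move=> sf ss; elim: r => [|i r IH].
  apply: smooth_section_ext (smooth_section0 p).
  by apply: nearW => q; rewrite big_nil.
apply: smooth_section_ext (smooth_section_scaleD (sf i) (ss i) IH).
by apply: nearW => q; rewrite big_cons.
Qed.

(** By the chain rule, the coordinates of the image of [X] in the chart at [phi p] are the
    derivatives along [X] of [phi] read in that chart. *)
Lemma smooth_section_tangent_map (X : vector_field M) p : smooth_field X p ->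
  smooth_section (fun q => tangent_map phi (X q)) p.
Proof.
move=> sX; have [_ /(_ p) sphi] := smooth_phi.
apply: smooth_near_ext (smooth_near_dirder sphi sX).
apply: filterS (near_map_dom p) => q dq.
by rewrite dirder_tangent_map//; exact: differentiable_near_chart.
Qed.

Lemma smooth_section_pullback (Z : vector_field N) p : smooth_field Z (phi p) ->
  smooth_section (fun q => Z (phi q)) p.
Proof. by move=> sZ; exact: smooth_near_comp sZ. Qed.

(** This local expansion in pulled-back coordinate fields stands in for an extension of [s] to a
    field on [N]. *)
Lemma section_coordE s p : \forall q \near p,
  \sum_a (dirder (chart (phi p)) (s q)) 0 a *: tvec (phi p) (phi q) (delta_mx 0 a)
  = s q.
Proof.
apply: filterS (near_map_dom p) => q dq.
by rewrite -tvec_sum// -row_sum_delta dirderK.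
Qed.

End SmoothMap.

Section Fields.
Context {R : realType} {n : nat} {M : manifold R n}.

Lemma smooth_map_id : smooth_map (@id M).
Proof. by split=> [x|p]; [exact: cvg_id|exact: smooth_near_chart]. Qed.

Lemma smooth_field_tvec (p : M) (xi : 'rV[R]_n) :
  smooth_field (fun q => tvec p q xi) p.
Proof.
apply: smooth_near_ext (smooth_near_cst xi p).
by apply: filterS (near_chart_dom (chart_dom_self p)) => q dq; rewrite tvecK.
Qed.

End Fields.

(** * Rules of calculus for an abstract connection *)

Section Connection.
Context {R : realType} {n n' : nat} {M : manifold R n} {N : manifold R n'}.
Variables (phi : M -> N).
Variable D : forall p : M, tangent p -> section_along phi -> tangent (phi p).
Hypothesis smooth_phi : smooth_map phi.
Hypothesis connD : is_connection D.
Implicit Types (p : M) (s t : section_along phi).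

(* Multiplication by the indicator function of a neighbourhood does not change
   the covariant derivative. *)
Lemma connection_ext p (v : tangent p) s t :
  (\forall q \near p, s q = t q) -> smooth_section s p -> D v s = D v t.
Proof.
move=> st ss; have sst := smooth_section_ext st ss.
pose f (q : M) : R^o := if `[< s q = t q >] then 1 else 0.
have f1 : \forall q \near p, f q = 1.
  by apply: filterS st => q; rewrite /f => /asboolP ->.
have sf : smooth_near f p.
  apply: smooth_near_ext (smooth_near_cst (1 : R^o) p).
  by apply: filterS f1 => q ->.
have Df u : smooth_section u p -> D v (fun q => (f q : R) *: u q) = D v u.
  move=> su; rewrite (connection_leibniz connD v sf su).
  have -> : dirder f v = 0 by rewrite (near_eq_dirder v f1) dirder_cst.
  by rewrite (nbhs_singleton f1) scale0r add0r scale1r.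
rewrite -(Df s)// -(Df t)//; congr (D v); apply/functional_extensionality_dep => q.
by rewrite /f; case: asboolP => [->|]//; rewrite !scale0r.
Qed.

Lemma connection0 p (v : tangent p) : D v (fun q => 0) = 0.
Proof.
have s0 := smooth_section0 phi p.
have := connection_leibniz connD v (smooth_near_cst (0 : R^o) p) s0.
rewrite /= scaler0 scale0r addr0 => D0; rewrite -[RHS]D0; congr (D v).
by apply/functional_extensionality_dep => q; rewrite scaler0.
Qed.

Lemma connectionN p (v : tangent p) s : smooth_section s p ->
  D v (fun q => - s q) = - D v s.
Proof.
move=> ss; have := connection_leibniz connD v (smooth_near_cst (-1 : R^o) p) ss.
rewrite dirder_cst scale0r add0r scaleN1r => <-; congr (D v).
by apply/functional_extensionality_dep => q; rewrite scaleN1r.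
Qed.

Lemma connection_sum (I : Type) (r : seq I) (f : I -> M -> R^o)
    (s : I -> section_along phi) p (v : tangent p) :
  (forall i, smooth_near (f i) p) -> (forall i, smooth_section (s i) p) ->
  D v (fun q => \sum_(i <- r) (f i q : R) *: s i q) =
  \sum_(i <- r) ((dirder (f i) v : R) *: s i p + (f i p : R) *: D v (s i)).
Proof.
move=> sf ss; elim: r => [|i r IH].
  rewrite big_nil -[RHS](connection0 v); congr (D v).
  by apply/functional_extensionality_dep => q; rewrite big_nil.
rewrite big_cons -(connection_leibniz connD v (sf i) (ss i)) -IH.
rewrite -connection_additive//; last 2 first.
- exact: smooth_section_scale.
- exact: smooth_section_sum.
by congr (D v); apply/functional_extensionality_dep => q; rewrite big_cons.
Qed.

Lemma connection_dir_sum (I : Type) (r : seq I) (a : I -> R) p (u : I -> tangent p) s :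
  smooth_section s p ->
  D (\sum_(i <- r) a i *: u i) s = \sum_(i <- r) a i *: D (u i) s.
Proof.
move=> ss; elim: r => [|i r IH].
  rewrite !big_nil; have := connection_linear connD 1 0 0 ss.
  rewrite scaler0 addr0 scale1r => /(congr1 (fun w => w - D (0 : tangent p) s)).
  by rewrite subrr addrK => <-.
by rewrite !big_cons (connection_linear connD)// IH.
Qed.

End Connection.

(** * Almost complex structures and pull-back connections *)

Lemma subDr_cancel (V : zmodType) (a b c : V) : (a + c) - (b + c) = a - b.
Proof. by rewrite opprD addrACA subrr addr0. Qed.

(** Pattern of the tensoriality of $\nabla J$ in the section: [x] and [y] stand for the terms that
    differentiate the coefficient [f]. *)
Lemma scale_cancel (K : pzRingType) (V : lmodType K) (f : K) (x y a b c d : V) :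
  (x + f *: a) - (x + f *: b) + ((y + f *: c) - (y + f *: d))
  = f *: ((a - b) + (c - d)).
Proof.
by rewrite scalerDr !scalerBr ![_ + f *: _]addrC !subDr_cancel.
Qed.

Section Hermitian.
Context {R : realType} {m : nat} {M : almost_hermitian R m}.
Implicit Types p : M.

Lemma acs0 p : acs (0 : tangent p) = 0.
Proof.
have := acs_linear (-1) (0 : tangent p) 0.
by rewrite scaler0 addr0 scaleN1r addNr.
Qed.

Lemma acsD p (u v : tangent p) : acs (u + v) = acs u + acs v.
Proof. by have := acs_linear 1 u v; rewrite !scale1r. Qed.

Lemma acsZ p (a : R) (u : tangent p) : acs (a *: u) = a *: acs u.
Proof. by have := acs_linear a u 0; rewrite acs0 !addr0. Qed.

Lemma acsN p (u : tangent p) : acs (- u) = - acs u.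
Proof. by rewrite -scaleN1r acsZ scaleN1r. Qed.

Lemma acs_sum p (I : Type) (r : seq I) (u : I -> tangent p) :
  acs (\sum_(i <- r) u i) = \sum_(i <- r) acs (u i).
Proof.
elim: r => [|i r IH]; first by rewrite !big_nil acs0.
by rewrite !big_cons acsD IH.
Qed.

Lemma nabla_J_acs (nabla : forall p : M, tangent p -> vector_field M -> tangent p)
    p (v : tangent p) (Y : vector_field M) :
  is_connection (phi := id) nabla -> smooth_field Y p ->
  nabla_J nabla v (fun q => acs (Y q)) = - nabla p v Y - acs (nabla p v (fun q => acs (Y q))).
Proof.
move=> cn sY; rewrite /nabla_J -(connectionN cn v sY); congr (_ - _).
congr (nabla p v); apply/functional_extensionality_dep => q.
by rewrite acs_square.
Qed.

End Hermitian.

(** * Torsion-freeness and its form along a map *)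

Section TorsionFree.
Context {R : realType} {n : nat} {N : manifold R n}.
Variable nabla : forall p : N, tangent p -> vector_field N -> tangent p.
Hypothesis tf : torsion_free nabla.

(** Coordinate fields commute. The derivative of a coordinate function along a field with constant
    coordinates is constant near [c], so both second derivatives vanish; testing the torsion
    identity on every coordinate function kills the difference. *)
Lemma torsion_free_tvec (c : N) (xi eta : tangent c) :
  nabla xi (fun y => tvec c y eta) = nabla eta (fun y => tvec c y xi).
Proof.
apply/subr0_eq; set w := _ - _; apply/rowP => i; rewrite -(dirder_chart_self w) mxE.
have dc : differentiable_near (chart c) c by exact/differentiable_near_chart/chart_dom_self.
rewrite /dirder derive_rV// -/(dirder (fun y => chart c y 0 i : R^o) w).
have cst_dir (zeta : 'rV[R]_n) : \forall y \near c,
    dirder (fun y => chart c y 0 i : R^o) (tvec c y zeta) = zeta 0 i.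
  apply: filterS (near_chart_dom (chart_dom_self c)) => y cy.
  rewrite -[in RHS](tvecK zeta cy) /dirder derive_rV//.
  exact: differentiable_near_chart.
have := tf (smooth_field_tvec c xi) (smooth_field_tvec c eta)
  (smooth_near_coord i (smooth_near_chart c)).
have d0 (zeta : 'rV[R]_n) (v : tangent c) : dirder
    (fun y => dirder (fun y' => chart c y' 0 i : R^o) (tvec c y zeta)) v = 0.
  by apply: etrans (dirder_cst (zeta 0 i : R^o) v); exact: near_eq_dirder.
rewrite !tvec_self => ->.
exact: etrans (congr2 (fun a b => a - b) (d0 eta _) (d0 xi _)) (subrr 0).
Qed.

End TorsionFree.

Section Pullback.
Context {R : realType} {m n : nat} {M : manifold R m} {N : manifold R n}.
Variables (phi : M -> N).
Variable nablaN : forall p : N, tangent p -> vector_field N -> tangent p.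
Variable D : forall p : M, tangent p -> section_along phi -> tangent (phi p).
Hypothesis smooth_phi : smooth_map phi.
Hypothesis connN : is_connection (phi := id) nablaN.
Hypothesis pullD : pullback_connection nablaN D.
Implicit Types (p : M) (s : section_along phi).

(** The Leibniz rule and the values on sections of the form [Z \o phi] determine [D], since
    [section_coordE] supplies such an expansion for any section. *)
Lemma pullback_expand p (v : tangent p) s (I : finType) (f : I -> M -> R^o)
    (Z : I -> vector_field N) :
  (forall a, smooth_near (f a) p) -> (forall a, smooth_field (Z a) (phi p)) ->
  (\forall q \near p, \sum_a (f a q : R) *: Z a (phi q) = s q) ->
  D v s = \sum_a ((dirder (f a) v : R) *: Z a (phi p)
                  + (f a p : R) *: nablaN (tangent_map phi v) (Z a)).
Proof.
move=> sf sZ sE; have [connD pbD] := pullD.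
have sZp a := smooth_section_pullback smooth_phi (sZ a).
rewrite -(connection_ext connD v sE); last exact: smooth_section_sum.
by rewrite connection_sum//; apply: eq_bigr => a _; rewrite pbD.
Qed.

Definition coord_along p s (a : 'I_n) (q : M) : R^o :=
  dirder (chart (phi p)) (s q) 0 a.

Lemma smooth_coord_along p s a : smooth_section s p ->
  smooth_near (coord_along p s a) p.
Proof. exact: smooth_near_coord. Qed.

(** Expanded in the coordinate frame at [phi p], the derivative of $d\phi(V)$ along $V'$ has the
    components $V'(V\phi_a)$ plus a term symmetric in $V$ and $V'$. The difference leaves
    $[V',V]\phi_a$, which the torsion-freeness on $M$ turns into $d\phi(\nabla_{V'}V-\nabla_V
    V')$. *)
Lemma pullback_torsion_free (nablaM : forall p : M, tangent p -> vector_field M -> tangent p)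
    p (X Y : vector_field M) :
  torsion_free nablaM -> torsion_free nablaN ->
  smooth_field X p -> smooth_field Y p ->
  D (X p) (fun q => tangent_map phi (Y q)) - D (Y p) (fun q => tangent_map phi (X q))
  = tangent_map phi (nablaM p (X p) Y - nablaM p (Y p) X).
Proof.
move=> tfM tfN sX sY.
pose Z a : vector_field N := fun y => tvec (phi p) y (delta_mx 0 a).
have sZ a : smooth_field (Z a) (phi p) by exact: smooth_field_tvec.
pose phia a q : R^o := (chart (phi p) \o phi) q 0 a.
have [_ /(_ p) sphip] := smooth_phi.
have sphia a : smooth_near (phia a) p by exact: smooth_near_coord.
have coordE (V : vector_field M) a : \forall q \near p,
    coord_along p (fun q => tangent_map phi (V q)) a q = dirder (phia a) (V q).
  apply: filterS2 (near_map_dom smooth_phi p) (smooth_near_differentiable_near sphip) => q dq df.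
  rewrite /coord_along dirder_tangent_map//; last exact: differentiable_near_chart.
  by rewrite /dirder derive_rV.
have coordp (V : vector_field M) a :
    coord_along p (fun q => tangent_map phi (V q)) a p = tangent_map phi (V p) 0 a.
  by rewrite /coord_along dirder_chart_self.
(* In the last term direction and differentiated field are exchanged by [torsion_free_tvec], so that
   the sum over the frame collapses by linearity in the direction. *)
have nZ (V V' : vector_field M) : smooth_field V p -> D (V' p) (fun q => tangent_map phi (V q)) =
    \sum_a (dirder (fun q => dirder (phia a) (V q)) (V' p) : R) *: (delta_mx 0 a : 'rV[R]_n)
    + nablaN (tangent_map phi (V p)) (fun y => tvec (phi p) y (tangent_map phi (V' p))).
  move=> sV; have sdV := smooth_section_tangent_map smooth_phi sV.
  rewrite (pullback_expand (V' p) (fun a => smooth_coord_along a sdV) sZ (section_coordE smooth_phi _ p)).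
  rewrite big_split/=; congr (_ + _).
    by apply: eq_bigr => a _; rewrite (near_eq_dirder _ (coordE V a)) /Z tvec_self.
  rewrite [in RHS](row_sum_delta (tangent_map phi (V p))).
  have sw := smooth_field_tvec (phi p) (tangent_map phi (V' p)).
  apply/esym/(etrans (connection_dir_sum connN (index_enum 'I_n)
    (fun a => tangent_map phi (V p) 0 a) (fun a => delta_mx 0 a) sw))/esym.
  apply: eq_bigr => a _; rewrite coordp; congr (_ *: _).
  exact: torsion_free_tvec.
have tfE := torsion_free_tvec tfN (tangent_map phi (X p)) (tangent_map phi (Y p)).
rewrite (nZ Y X sY) (nZ X Y sX) tfE.
apply: etrans (subDr_cancel _ _ _) _.
rewrite -sumrB.
rewrite [RHS]row_sum_delta; apply: eq_bigr => a _; rewrite -scalerBl; congr (_ *: _).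
(* Torsion-freeness on $M$ is tested on the [a]-th component of [phi], whose derivative is the
   [a]-th coordinate of [tangent_map phi]. *)
apply: etrans (esym (tfM _ _ _ _ sX sY (sphia a))) _.
exact/esym/(derive_rV _ a (differentiable_near_map smooth_phi p)).
Qed.

End Pullback.

(** * The (1,2)-symplectic condition along a holomorphic map *)

Section Holomorphic.
Context {R : realType} {m n : nat} {M : almost_hermitian R m} {N : almost_hermitian R n}.
Variables (phi : M -> N).
Variable nablaM : forall p : M, tangent p -> vector_field M -> tangent p.
Variable nablaN : forall p : N, tangent p -> vector_field N -> tangent p.
Variable D : forall p : M, tangent p -> section_along phi -> tangent (phi p).
Hypothesis connM : is_connection (phi := id) nablaM.
Hypothesis connN : is_connection (phi := id) nablaN.
Hypothesis tfM : torsion_free nablaM.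
Hypothesis tfN : torsion_free nablaN.
Hypothesis pullD : pullback_connection nablaN D.
Hypothesis symplN : one_two_symplectic nablaN.
Hypothesis holphi : holomorphic phi.
Implicit Types (p : M) (s : section_along phi).

Let smooth_phi : smooth_map phi. Proof. by case: holphi. Qed.

(** The expression is linear over functions in [s], so it reduces to the coordinate fields of [N],
    where the hypothesis on [N] applies. Holomorphy makes the direction $d\phi(Jv)$ equal to the
    required $J d\phi(v)$. *)
Lemma pullback_one_two_symplectic p (v : tangent p) s : smooth_section s p ->
  D v (fun q => acs (s q)) - acs (D v s)
  + (D (acs v) (fun q => acs (acs (s q))) - acs (D (acs v) (fun q => acs (s q)))) = 0.
Proof.
move=> ss; have [_ hol] := holphi.
pose Z a : vector_field N := fun y => tvec (phi p) y (delta_mx 0 a).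
have sZ a : smooth_field (Z a) (phi p) by exact: smooth_field_tvec.
have sJZ a : smooth_field (fun y => acs (Z a y)) (phi p) by exact: acs_smooth.
have sJJZ a : smooth_field (fun y => acs (acs (Z a y))) (phi p).
  by apply: (@acs_smooth _ _ _ _ (fun y => acs (Z a y))).
have sE := section_coordE smooth_phi s p.
have sf a := smooth_coord_along a ss.
have JE : \forall q \near p,
    \sum_a (coord_along p s a q : R) *: acs (Z a (phi q)) = acs (s q).
  by apply: filterS sE => q <-; rewrite acs_sum; apply: eq_bigr => a _; rewrite acsZ.
have JJE : \forall q \near p,
    \sum_a (coord_along p s a q : R) *: acs (acs (Z a (phi q))) = acs (acs (s q)).
  by apply: filterS JE => q <-; rewrite acs_sum; apply: eq_bigr => a _; rewrite acsZ.
have ex := pullback_expand smooth_phi pullD.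
rewrite (ex _ v _ _ _ _ sf sZ sE) (ex _ v _ _ _ _ sf sJZ JE).
rewrite (ex _ (acs v) _ _ _ _ sf sJJZ JJE) (ex _ (acs v) _ _ _ _ sf sJZ JE).
rewrite !acs_sum -!sumrB -big_split/= big1// => a _.
rewrite !acsD !acsZ; apply: etrans (scale_cancel _ _ _ _ _ _ _) _.
(* The hypothesis on [N] asks for a field in the direction slot: the one with constant coordinates
   that takes the value $d\phi(v)$ at [phi p]. *)
have := symplN (smooth_field_tvec (phi p) (tangent_map phi v)) (sZ a).
by rewrite tvec_self -!hol => ->; rewrite scaler0.
Qed.

Lemma acs_trace_pullback p (X : vector_field M) : smooth_field X p ->
  acs (D (X p) (fun q => tangent_map phi (X q))
       + D (acs (X p)) (fun q => tangent_map phi (acs (X q)))) =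
  tangent_map phi (nablaM (X p) (fun q => acs (X q)) - nablaM (acs (X p)) X).
Proof.
move=> sX; have [_ hol] := holphi; have sJX := acs_smooth sX.
have sdX := smooth_section_tangent_map smooth_phi sX.
rewrite -(pullback_torsion_free smooth_phi connN pullD tfM tfN sX sJX).
have JE : (fun q => acs (tangent_map phi (X q))) = (fun q => tangent_map phi (acs (X q))).
  by apply/functional_extensionality_dep => q; rewrite hol.
have JJE : (fun q => acs (acs (tangent_map phi (X q)))) = (fun q => - tangent_map phi (X q)).
  by apply/functional_extensionality_dep => q; rewrite acs_square.
have := pullback_one_two_symplectic (X p) sdX; rewrite JE JJE.
have [connD _] := pullD; rewrite (connectionN connD)//.
rewrite acsD => E; apply/esym/subr0_eq; rewrite -[RHS]E !opprD -!addrA; congr (_ + _).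
by rewrite addrCA.
Qed.

Lemma acs_tension_term p (X : vector_field M) : smooth_field X p ->
  acs (D (X p) (fun q => tangent_map phi (X q)) - tangent_map phi (nablaM (X p) X)
       + (D (acs (X p)) (fun q => tangent_map phi (acs (X q)))
          - tangent_map phi (nablaM (acs (X p)) (fun q => acs (X q))))) =
  tangent_map phi (nabla_J nablaM (X p) X
                   + nabla_J nablaM (acs (X p)) (fun q => acs (X q))).
Proof.
move=> sX; have [_ hol] := holphi.
rewrite addrACA -opprD -tangent_mapD// acsD acs_trace_pullback// acsN -hol.
apply: etrans (esym (tangent_mapB smooth_phi _ _)) _.
congr tangent_map.
by rewrite nabla_J_acs// /nabla_J acsD opprD addrACA.
Qed.

End Holomorphic.

(** * Orthonormal frames *)

Section Metric.
Context {R : realType} {n : nat} {M : riemannian R n}.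
Implicit Types p q : M.

Lemma metricC p (u v : tangent p) : metric u v = metric v u.
Proof. exact: Defs.metric_sym. Qed.

Lemma metric0l p (w : tangent p) : metric 0 w = 0.
Proof.
have := metric_linear (-1) (0 : tangent p) 0 w.
by rewrite scaler0 addr0 mulN1r addNr.
Qed.

Lemma metricDl p (u v w : tangent p) : metric (u + v) w = metric u w + metric v w.
Proof. by have := metric_linear 1 u v w; rewrite scale1r mul1r. Qed.

Lemma metricZl p a (u w : tangent p) : metric (a *: u) w = a * metric u w.
Proof. by have := metric_linear a u 0 w; rewrite metric0l !addr0. Qed.

Lemma metricZr p a (u w : tangent p) : metric w (a *: u) = a * metric w u.
Proof. by rewrite metricC metricZl metricC. Qed.

Lemma metricNl p (u w : tangent p) : metric (- u) w = - metric u w.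
Proof. by rewrite -scaleN1r metricZl mulN1r. Qed.

Lemma metric_suml p (I : Type) (r : seq I) (u : I -> tangent p) (w : tangent p) :
  metric (\sum_(i <- r) u i) w = \sum_(i <- r) metric (u i) w.
Proof.
elim: r => [|i r IH]; first by rewrite !big_nil metric0l.
by rewrite !big_cons metricDl IH.
Qed.

Lemma metric_orthonormal_sum p (I : finType) (a : I -> R) (u : I -> tangent p) j :
  (forall i k, metric (u i) (u k) = (i == k)%:R) ->
  metric (\sum_i a i *: u i) (u j) = a j.
Proof.
move=> ou; rewrite metric_suml (bigD1 j)//= big1 ?addr0.
  by rewrite metricZl ou eqxx mulr1.
by move=> i /negPf ij; rewrite metricZl ou ij mulr0.
Qed.

(** Orthonormality makes the matrix with rows [u i] row free, and it is square, hence invertible. So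
    the family spans, and pairing with [u i] identifies the coefficients. *)
Lemma orthonormal_expand p (u : 'I_n -> tangent p) (v : tangent p) :
  (forall i k, metric (u i) (u k) = (i == k)%:R) ->
  \sum_i metric v (u i) *: u i = v.
Proof.
move=> ou; pose A : 'M[R]_n := \matrix_i (u i : 'rV[R]_n).
have rowA (c : 'rV[R]_n) : c *m A = \sum_i c 0 i *: u i.
  by rewrite mulmx_sum_row; apply: eq_bigr => i _; rewrite rowK.
have freeA : row_free A.
  apply: inj_row_free => c cA0; apply/rowP => j.
  rewrite mxE -(metric_orthonormal_sum (fun i => c 0 i) j ou).
  by have := rowA c; rewrite cA0 => <-; rewrite metric0l.
have vA : v = (v : 'rV[R]_n) *m invmx A *m A.
  by rewrite mulmxKV// -row_free_unit.
have := rowA (v *m invmx A); rewrite -vA => vE.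
rewrite [RHS]vE; apply: eq_bigr => i _; congr (_ *: _).
by rewrite {1}vE (metric_orthonormal_sum _ _ ou).
Qed.

(** The span has rank at most [#|I|], less than [n], so it misses some row of the identity
    matrix. *)
Lemma exists_not_in_span (I : finType) p (u : I -> tangent p) : (#|I| < n)%N ->
  exists v : tangent p, forall a : I -> R, v - \sum_i a i *: u i != 0.
Proof.
move=> In; pose A : 'M[R]_(#|I|, n) := \matrix_i (u (enum_val i) : 'rV[R]_n).
have /row_subPn[i vA] : ~~ (1%:M <= A)%MS.
  apply/negP => /mxrankS; rewrite mxrank1 => nA.
  by have := leq_trans nA (rank_leq_row A); rewrite leqNgt In.
exists (row i 1%:M) => a; apply: contra vA; rewrite subr_eq0 => /eqP ->.
apply: summx_sub => j _; apply: scalemx_sub.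
have -> : u j = row (enum_rank j) A by rewrite rowK enum_rankK.
exact: row_sub.
Qed.

(** One Gram-Schmidt step for fields. The residual [W] is nonzero at [p] by the choice of [v];
    continuity of its squared norm keeps it nonzero nearby, which allows normalization on a whole
    neighbourhood. *)
Lemma smooth_orthonormal_extension (I : finType) p (u : I -> vector_field M) :
  (#|I| < n)%N -> (forall i, smooth_field (u i) p) ->
  (\forall q \near p, forall i k, metric (u i q) (u k q) = (i == k)%:R) ->
  exists2 e : vector_field M, smooth_field e p &
    \forall q \near p, metric (e q) (e q) = 1 /\ forall i, metric (e q) (u i q) = 0.
Proof.
move=> In su ou; have sid := @smooth_map_id _ _ M.
have [v vu] := exists_not_in_span (fun i => u i p) In.
have [V sV Vp] : exists2 V : vector_field M, smooth_field V p & V p = v.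
  by exists (fun q => tvec p q v); [exact: smooth_field_tvec|exact: tvec_self].
(* [P] is the projection of [V] onto the span of the family, orthogonal wherever the family is
   orthonormal. *)
have [P PE] : exists P : vector_field M,
    forall q, P q = \sum_i metric (V q) (u i q) *: u i q by eexists.
have sP : smooth_field P p.
  have sVu i : smooth_near (fun q => metric (V q) (u i q) : R^o) p.
    exact: (metric_smooth sV (su i)).
  have := smooth_section_sum sid (index_enum I) sVu su.
  by apply: (smooth_section_ext (phi := id)); apply: nearW => q; rewrite PE.
have [W WE] : exists W : vector_field M, forall q, W q = -1 *: P q + V q by eexists.
have sW : smooth_field W p.
  have := smooth_section_scaleD sid (smooth_near_cst (-1 : R^o) p) sP sV.
  by apply: (smooth_section_ext (phi := id)); apply: nearW => q; rewrite WE.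
have sWW : smooth_near (fun q => metric (W q) (W q) : R^o) p.
  exact: (metric_smooth sW sW).
have W0 : 0 < metric (W p) (W p).
  by apply: metric_pos; rewrite WE scaleN1r addrC PE Vp; exact: vu.
have Wgt0 : \forall q \near p, 0 < metric (W q) (W q).
  by exact: (cvgr_gt (metric (W p) (W p)) (smooth_near_continuous sWW)).
exists (fun q => (Num.sqrt (metric (W q) (W q)))^-1 *: W q).
  exact: (smooth_section_scale sid (smooth_near_invsqrt W0 sWW) sW).
apply: filterS2 ou Wgt0 => q ou Wq; split=> [|i].
  rewrite metricZl metricZr mulrA -invfM -expr2 sqr_sqrtr ?mulVf//.
    by rewrite gt_eqF.
  exact: ltW.
have Pu : metric (P q) (u i q) = metric (V q) (u i q).
  by rewrite PE (@metric_orthonormal_sum _ _ _ (fun k => u k q) i ou).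
have Wu : metric (W q) (u i q) = 0.
  by rewrite WE metricDl metricZl Pu mulN1r addNr.
by rewrite metricZl Wu mulr0.
Qed.

End Metric.

(** * Orthonormal frames adapted to $J$ *)

Section UnitaryFrame.
Context {R : realType} {m : nat} {M : almost_hermitian R m}.
Implicit Types p q : M.

Lemma metric_acsl p (u v : tangent p) : metric (acs u) v = - metric u (acs v).
Proof.
by rewrite -(acs_isometric (acs u) v) acs_square metricNl.
Qed.

(** An isometric $J$ with $J^2=-1$ is skew, so the value equals its own opposite. *)
Lemma metric_acs_self p (u : tangent p) : metric u (acs u) = 0.
Proof.
have /eqP := metric_acsl u u; rewrite metricC -addr_eq0 -mulr2n -mulr_natl.
by rewrite mulf_eq0 pnatr_eq0 => /eqP.
Qed.

Lemma J_family_lshift (e : 'I_m -> vector_field M) k : J_family e (lshift m k) = e k.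
Proof. by rewrite /J_family (unsplitK (inl k)). Qed.

Lemma J_family_rshift (e : 'I_m -> vector_field M) k :
  J_family e (rshift m k) = (fun q => acs (e k q)).
Proof. by rewrite /J_family (unsplitK (inr k)). Qed.

(** Only [E] has to be constructed at each stage: if it is orthogonal to all $e_i$ and $Je_i$,
    skewness of $J$ makes $JE$ orthogonal to them too, and to [E]. Indexing by [nat] with bounds
    lets the family grow without casts between ordinals. *)
Lemma exists_unitary_family p k : (k <= m)%N -> exists e : nat -> vector_field M,
  (forall i, (i < k)%N -> smooth_field (e i) p) /\
  \forall q \near p, forall i j, (i < k)%N -> (j < k)%N ->
    metric (e i q) (e j q) = (i == j)%:R /\ metric (e i q) (acs (e j q)) = 0.
Proof.
elim: k => [|k IH] km.
  by exists (fun _ _ => 0); split=> //; apply: nearW => q.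
have [e [se oe]] := IH (ltnW km).
pose u (x : 'I_k + 'I_k) : vector_field M :=
  match x with inl i => e i | inr i => fun q => acs (e i q) end.
have cu : (#|{: 'I_k + 'I_k}| < m + m)%N.
  by rewrite card_sum card_ord -addSn leq_add// ltnW.
have su x : smooth_field (u x) p.
  by case: x => i /=; [|apply: acs_smooth]; exact: se.
have ou : \forall q \near p, forall x y, metric (u x q) (u y q) = (x == y)%:R.
  apply: filterS oe => q oe [i|i] [j|j] /=; have [ee eJe] := oe i j (ltn_ord _) (ltn_ord _).
  - exact: ee.
  - exact: eJe.
  - by rewrite metric_acsl eJe oppr0.
  - by rewrite acs_isometric; exact: ee.
have [E sE oE] := smooth_orthonormal_extension cu su ou.
exists (fun i => if i == k then E else e i); split=> [i|].
  rewrite ltnS; case: eqVneq => [//|ik] ik'; apply: se.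
  by rewrite ltn_neqAle ik.
apply: filterS2 oe oE => q oe [EE Eu] i j; rewrite !ltnS => ik jk.
case: (eqVneq i k) ik => [->|ik] ik'; case: (eqVneq j k) jk => [->|jk] jk'.
- by rewrite EE metric_acs_self.
- have jlt : (j < k)%N by rewrite ltn_neqAle jk.
  by have /= := Eu (inl (Ordinal jlt)); have /= := Eu (inr (Ordinal jlt)).
- have ilt : (i < k)%N by rewrite ltn_neqAle ik.
  have := Eu (inl (Ordinal ilt)); have := Eu (inr (Ordinal ilt)) => /= E1 E2.
  rewrite (negPf ik) metricC E2; split=> //.
  by rewrite metricC metric_acsl E1 oppr0.
- by apply: oe; rewrite ltn_neqAle ?ik ?jk.
Qed.

Lemma exists_J_frame p :
  exists e : 'I_m -> vector_field M, orthonormal_frame p (J_family e).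
Proof.
have [e [se oe]] := exists_unitary_family p (leqnn m).
exists (fun i => e i); split=> [a|].
  case: (split_ordP a) => k ->; rewrite ?J_family_lshift ?J_family_rshift.
    exact: se.
  by apply: acs_smooth; exact: se.
apply: filterS oe => q oe a b.
case: (split_ordP a) => i ->; case: (split_ordP b) => j ->;
  rewrite ?J_family_lshift ?J_family_rshift ?eq_lshift ?eq_rshift ?eq_lrshift ?eq_rlshift;
  have [ee eJe] := oe i j (ltn_ord _) (ltn_ord _).
- exact: ee.
- exact: eJe.
- by rewrite metric_acsl eJe oppr0.
- by rewrite acs_isometric; exact: ee.
Qed.

End UnitaryFrame.

(** * The tension field *)

Section SecondFundamentalForm.
Context {R : realType} {n n' : nat} {M : riemannian R n} {N : manifold R n'}.
Variables (phi : M -> N).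
Variable nabla : forall p : M, tangent p -> vector_field M -> tangent p.
Variable D : forall p : M, tangent p -> section_along phi -> tangent (phi p).
Hypothesis smooth_phi : smooth_map phi.
Hypothesis connM : is_connection (phi := id) nabla.
Hypothesis connD : is_connection D.
Implicit Types p : M.

Definition second_form p (v : tangent p) (X : vector_field M) : tangent (phi p) :=
  D v (fun q => tangent_map phi (X q)) - tangent_map phi (nabla v X).

Lemma second_form_dir_sum p (I : finType) (a : I -> R) (u : I -> tangent p) X :
  smooth_field X p ->
  second_form (\sum_i a i *: u i) X = \sum_i a i *: second_form (u i) X.
Proof.
move=> sX; have sdX := smooth_section_tangent_map smooth_phi sX.
have D1 := connection_dir_sum connD (index_enum I) a u sdX.
have D2 := connection_dir_sum connM (index_enum I) a u sX.
rewrite /second_form D1 D2 (tangent_map_sum smooth_phi).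
apply: etrans (esym (sumrB _ _ _ _)) _; apply: eq_bigr => i _.
by rewrite (tangent_mapZ smooth_phi) scalerBr.
Qed.

(** Tensoriality in the field: the terms that differentiate the coefficients contribute $d\phi(u_i)$
    with the same factor to both halves of the second fundamental form, and cancel. *)
Lemma second_form_field_sum p (v : tangent p) (I : finType) (a : I -> M -> R^o)
    (u : I -> vector_field M) (X : vector_field M) :
  (forall i, smooth_near (a i) p) -> (forall i, smooth_field (u i) p) ->
  (\forall q \near p, \sum_i (a i q : R) *: u i q = X q) ->
  second_form v X = \sum_i (a i p : R) *: second_form v (u i).
Proof.
move=> sa su uX; have sid := @smooth_map_id _ _ M.
have sdu i := smooth_section_tangent_map smooth_phi (su i).
have E1 : nabla v X =
    \sum_i ((dirder (a i) v : R) *: u i p + (a i p : R) *: nabla v (u i)).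
  have ss := smooth_section_sum sid (index_enum I) sa su.
  have := connection_ext connM v uX ss.
  by move=> <-; exact: (connection_sum sid connM (index_enum I) v sa su).
have E2 : D v (fun q => tangent_map phi (X q)) =
    \sum_i ((dirder (a i) v : R) *: tangent_map phi (u i p)
            + (a i p : R) *: D v (fun q => tangent_map phi (u i q))).
  have uX' : \forall q \near p, \sum_i (a i q : R) *: tangent_map phi (u i q)
      = tangent_map phi (X q).
    apply: filterS uX => q <-; rewrite (tangent_map_sum smooth_phi).
    by apply: eq_bigr => i _; rewrite (tangent_mapZ smooth_phi).
  have ss := smooth_section_sum smooth_phi (index_enum I) sa sdu.
  have := connection_ext connD v uX' ss.
  by move=> <-; exact: (connection_sum smooth_phi connD (index_enum I) v sa sdu).
rewrite /second_form E1 E2 (tangent_map_sum smooth_phi).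
apply: etrans (esym (sumrB _ _ _ _)) _; apply: eq_bigr => i _.
rewrite (tangent_mapD smooth_phi) !(tangent_mapZ smooth_phi) scalerBr.
by rewrite [X in X - _]addrC [X in _ - X]addrC; exact: subDr_cancel.
Qed.

Definition second_form_trace p (e : 'I_n -> vector_field M) :=
  \sum_(j < n) second_form (e j p) (e j).

(** Expanding each [f j] in the frame [e], in both slots, leaves the products of change-of-frame
    coefficients summed over [j]; that matrix is orthogonal. *)
Lemma second_form_trace_frame p (e f : 'I_n -> vector_field M) :
  orthonormal_frame p e -> orthonormal_frame p f ->
  second_form_trace p f = second_form_trace p e.
Proof.
move=> [se oe] [sf of_].
have oep := nbhs_singleton oe; have ofp := nbhs_singleton of_.
have fE j : second_form (f j p) (f j) =
    \sum_i \sum_k (metric (f j p) (e i p) * metric (f j p) (e k p)) *: second_form (e k p) (e i).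
  have sa i : smooth_near (fun q => metric (f j q) (e i q) : R^o) p.
    exact: (metric_smooth (sf j) (se i)).
  have fex : \forall q \near p, \sum_i metric (f j q) (e i q) *: e i q = f j q.
    by apply: filterS oe => q oeq; exact: (orthonormal_expand (f j q) oeq).
  rewrite (second_form_field_sum (f j p) sa se fex); apply: eq_bigr => i _.
  rewrite -{2}(orthonormal_expand (f j p) oep).
  rewrite (second_form_dir_sum _ _ (se i)) scaler_sumr.
  by apply: eq_bigr => k _; rewrite scalerA.
(* Obtained by expanding [e i] in the frame [f] and pairing with [e k]. *)
have orth i k : \sum_j metric (f j p) (e i p) * metric (f j p) (e k p) = (i == k)%:R.
  rewrite -oep -[in RHS](orthonormal_expand (e i p) ofp) metric_suml.
  by apply: eq_bigr => j _; rewrite metricZl [metric (e i p) _]metricC.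
apply: etrans (eq_bigr _ (fun j _ => fE j)) _.
apply: etrans (exchange_big _ _ _ _ _ _) _; apply: eq_bigr => i _.
apply: etrans (exchange_big _ _ _ _ _ _) _.
have E k : \sum_j (metric (f j p) (e i p) * metric (f j p) (e k p)) *: second_form (e k p) (e i)
    = (i == k)%:R *: second_form (e k p) (e i).
  by rewrite -orth; exact: esym (scaler_suml _ _ _ _).
apply: etrans (eq_bigr _ (fun k _ => E k)) _.
rewrite (bigD1 i)//= eqxx scale1r big1 ?addr0// => k /negPf ki.
by rewrite eq_sym ki scale0r.
Qed.

(** The existence of [e] excludes the default value of [xget], and frame independence replaces the
    selected frame by [e]. *)
Lemma tension_fieldE p (e : 'I_n -> vector_field M) : orthonormal_frame p e ->
  tension_field nabla D p = second_form_trace p e.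
Proof.
move=> oe; rewrite /tension_field; case: xgetP => [_ _ [f of_ ->]|].
  exact: second_form_trace_frame.
by move=> /(_ (second_form_trace p e))[]; exists e.
Qed.

End SecondFundamentalForm.

(** Exposes the adapted frame selected in [div_J], in which the tension field is then computed. The
    default value 0 is excluded by [exists_J_frame]. *)
Lemma div_JE (R : realType) (m : nat) (M : almost_hermitian R m)
    (nabla : forall p : M, tangent p -> vector_field M -> tangent p) (p : M) :
  exists2 e : 'I_m -> vector_field M, orthonormal_frame p (J_family e) &
    div_J nabla p = \sum_(k < m) (nabla_J nabla (e k p) (e k)
                      + nabla_J nabla (acs (e k p)) (fun q => acs (e k q))).
Proof.
rewrite /div_J; case: xgetP => [_ _ //|no_frame].
have [e oe] := exists_J_frame p.
by case: (no_frame _ (ex_intro2 _ _ e oe erefl)).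
Qed.

Lemma acs_tension_field (R : realType) (m n : nat)
    (M : almost_hermitian R m) (N : almost_hermitian R n)
    (nablaM : forall p : M, tangent p -> vector_field M -> tangent p)
    (nablaN : forall p : N, tangent p -> vector_field N -> tangent p)
    (phi : M -> N)
    (nablaphi : forall p : M, tangent p -> section_along phi -> tangent (phi p))
    (p : M) :
  levi_civita nablaM -> levi_civita nablaN ->
  pullback_connection nablaN nablaphi ->
  one_two_symplectic nablaN -> holomorphic phi ->
  acs (tension_field nablaM nablaphi p) = tangent_map phi (div_J nablaM p).
Proof.
move=> [connM tfM _] [connN tfN _] pull sympl hol.
have [smooth_phi _] := hol; have [connD _] := pull.
have [e oe ->] := div_JE nablaM p.
(* The trace over the adapted frame splits into its $e_k$ and $Je_k$ halves, which are paired index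
   by index to match the sum defining $\delta J$. *)
rewrite (tension_fieldE smooth_phi connM connD oe) /second_form_trace big_split_ord/=.
rewrite -big_split/= acs_sum (tangent_map_sum smooth_phi); apply: eq_bigr => k _.
rewrite J_family_lshift J_family_rshift.
apply: (acs_tension_term connM connN tfM tfN pull sympl hol).
by have [se _] := oe; have := se (lshift m k); rewrite J_family_lshift.
Qed.

Theorem proposition4p2 (R : realType) (m n : nat)
    (M : almost_hermitian R m) (N : almost_hermitian R n)
    (nablaM : forall p : M, tangent p -> vector_field M -> tangent p)
    (nablaN : forall p : N, tangent p -> vector_field N -> tangent p)
    (phi : M -> N)
    (nablaphi : forall p : M, tangent p -> section_along phi -> tangent (phi p)) :
  levi_civita nablaM -> levi_civita nablaN ->
  pullback_connection nablaN nablaphi ->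
  one_two_symplectic nablaN -> holomorphic phi ->
  harmonic_map nablaM nablaphi <->
  (forall p : M, tangent_map phi (acs (div_J nablaM p)) = 0).
Proof.
move=> lcM lcN pull sympl hol.
have tau p : tangent_map phi (acs (div_J nablaM p)) = - tension_field nablaM nablaphi p.
  have [_ ->] := hol.
  by rewrite -(acs_tension_field p lcM lcN pull sympl hol) acs_square.
split=> H p; first by rewrite tau H oppr0.
by apply/eqP; rewrite -oppr_eq0 -tau H.
Qed.
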